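(* Let $(\rho,u)$ be a solution on $[\sigma_\ell,\sigma_p]$, satisfying $0\le u(x)\le x$ and $\rho(x)\ge 0$ for all $x\in[\sigma_\ell,\sigma_p]$, of the system $$\rho'(x)=-\frac{2u(x)\,(u(x)-x)}{x\bigl((u(x)-x)^2-c(x)^2\bigr)}\,\rho(x),\qquad u'(x)=\frac{2c(x)^2}{x\bigl((u(x)-x)^2-c(x)^2\bigr)}\,u(x),$$ with $\rho(\sigma_p)=\rho_1$ and $u(\sigma_p)=u_1$. Then $\rho$ and $u$ are two decreasing functions over $[\sigma_\ell,\sigma_p]$. Consequently, $\rho\ge\rho_1>0$ and $u\ge u_1>0$ over $[\sigma_\ell,\sigma_p]$.
   Context: Data: real numbers $\gamma_u>1$, $\rho_0>0$, $p_0>0$; $c_0=(\gamma_u p_0/\rho_0)^{1/2}$; a precursor shock speed $\sigma_p>c_0$, with $M_p=\sigma_p/c_0>1$. The state $(\rho_1,u_1,p_1)$ behind the precursor shock is $$\rho_1=\frac{\gamma_u+1}{\gamma_u-1+2/M_p^2}\,\rho_0,\quad u_1=\Bigl(1-\frac{\rho_0}{\rho_1}\Bigr)\sigma_p,\quad p_1=p_0+\Bigl(1-\frac{\rho_0}{\rho_1}\Bigr)\rho_0\,\sigma_p^2,$$ and $s_1=p_1/\rho_1^{\gamma_u}$. Given a function $\rho\ge 0$, $c(x)\ge 0$ is defined by $c(x)^2=\gamma_u s_1\,\rho(x)^{\gamma_u-1}$. For $\sigma\in[0,\sigma_p)$, a solution on $[\sigma,\sigma_p]$ is a pair $(\rho,u)$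 of real functions, continuous on $[\sigma,\sigma_p]$ and continuously differentiable at all $x>0$ of this interval, with $\rho\ge0$, such that $(u(x)-x)^2-c(x)^2\ne 0$ and the two differential equations of the system hold at each $x>0$ in $[\sigma,\sigma_p]$, and such that $\rho(\sigma_p)=\rho_1$, $u(\sigma_p)=u_1$. $\sigma_\ell$ is the smallest real number (infimum) of the set of $\sigma\in[0,\sigma_p)$ for which there is a solution on $[\sigma,\sigma_p]$ satisfying $0\le u(x)\le x$ and $\rho(x)\ge 0$ for all $x\in[\sigma,\sigma_p]$. *)

(* Defs.v *)
From HB Require Import structures.
From mathcomp Require Import all_boot all_order all_algebra.
From mathcomp Require Import all_classical all_reals all_analysis.

Set Implicit Arguments.
Unset Strict Implicit.
Unset Printing Implicit Defensive.

Import Order.TTheory GRing.Theory Num.Theory.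
Import numFieldNormedType.Exports.

Local Open Scope classical_set_scope.
Local Open Scope ring_scope.

(* Derivative relative to [D]: two-sided at an interior point of [D],
   one-sided at an end-point when [D] is an interval. *)
Definition has_derive_within (R : realType) (D : set R) (f : R -> R)
    (x l : R) : Prop :=
  (f y - f x) / (y - x) @[y --> within D x^'] --> l.

Definition C1_within (R : realType) (D : set R) (f f' : R -> R) : Prop :=
  (forall x, D x -> has_derive_within D f x (f' x)) /\
  {within D, continuous f'}.

Section Precursor.
Context {R : realType}.
Variables gamma_u rho0 p0 sigma_p : R.

Definition c0 : R := Num.sqrt (gamma_u * p0 / rho0).

Definition M_p : R := sigma_p / c0.

Definition rho1 : R :=
  (gamma_u + 1) / (gamma_u - 1 + 2 / M_p ^+ 2) * rho0.

Definition u1 : R := (1 - rho0 / rho1) * sigma_p.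

Definition p1 : R := p0 + (1 - rho0 / rho1) * rho0 * sigma_p ^+ 2.

Definition s1 : R := p1 / rho1 `^ gamma_u.

Definition sound_speed (rho : R -> R) (x : R) : R :=
  Num.sqrt (gamma_u * s1 * rho x `^ (gamma_u - 1)).

(* Only the values of [rho] and [u] on [[sigma, sigma_p]] matter. The set [D]
   leaves out the end-point [0], where the system is singular, when
   [sigma = 0]. *)
Definition is_solution (sigma : R) (rho u : R -> R) : Prop :=
  let I := [set` `[sigma, sigma_p]] in
  let D := I `&` [set x | 0 < x] in
  let c := sound_speed rho in
  [/\ {within I, continuous rho} /\ {within I, continuous u},
      forall x, I x -> 0 <= rho x,
      forall x, D x -> (u x - x) ^+ 2 - c x ^+ 2 != 0,
      exists rho' u' : R -> R,
        [/\ C1_within D rho rho', C1_within D u u',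
            forall x, D x ->
              rho' x = - (2 * u x * (u x - x)
                            / (x * ((u x - x) ^+ 2 - c x ^+ 2))) * rho x
          & forall x, D x ->
              u' x = 2 * c x ^+ 2 / (x * ((u x - x) ^+ 2 - c x ^+ 2)) * u x]
    & rho sigma_p = rho1 /\ u sigma_p = u1].

Definition admissible (sigma : R) (rho u : R -> R) : Prop :=
  forall x, x \in `[sigma, sigma_p] -> 0 <= u x <= x /\ 0 <= rho x.

Definition sigma_l : R :=
  inf [set sigma | 0 <= sigma < sigma_p /\
    exists rho u : R -> R, is_solution sigma rho u /\ admissible sigma rho u].

End Precursor.

(* Main.v *)
Require Import Defs.
From HB Require Import structures.
From mathcomp Require Import all_boot all_order all_algebra.
From mathcomp Require Import all_classical all_reals all_analysis.
From mathcomp Require Import ring lra.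

Set Implicit Arguments.
Unset Strict Implicit.
Unset Printing Implicit Defensive.

Import Order.TTheory GRing.Theory Num.Theory.
Import numFieldNormedType.Exports.

Local Open Scope classical_set_scope.
Local Open Scope ring_scope.

(** The sign of [(u x - x) ^+ 2 - c x ^+ 2] decides the monotonicity of both
    functions. Since [0 <= u x <= x] and [0 <= rho x], the two differential
    equations give [rho' <= 0] and [u' <= 0] wherever this quantity is negative,
    that is, wherever the flow is subsonic relative to the ray [x].

    At [sigma_p] the flow is subsonic: this is the Lax condition for the
    precursor shock, and it reduces to [1 < M_p] (lemma [subsonic_behind_shock]).
    The quantity is continuous and never vanishes at a positive [x], so the
    intermediate value theorem carries its sign from [sigma_p] back to every
    [x > sigma] (lemma [subsonic]). Hence [rho] and [u] are nonincreasing on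
    the closed interval, and they stay above their values [rho1 > 0] and
    [u1 > 0] at [sigma_p].

    These bounds make the monotonicity strict. The derivative of [u] is a
    negative multiple of [c ^+ 2 * u], which is positive because [rho] and [u]
    are. The derivative of [rho] is a negative multiple of
    [u x * (x - u x) * rho x], and [x = u x] is impossible for [x > sigma],
    because [u x <= u sigma <= sigma < x].

    The argument works on [[sigma, sigma_p]] for every [sigma] in
    [[0, sigma_p)]; the infimum [sigma_l] enters only as one such [sigma]
    (lemma [sigma_l_itv]). *)

(** * Two facts of real analysis *)

(** [powR] with a positive exponent is continuous on the half-line [0 <= y] but
    not across [0], as its value is [1] at every negative base. Truncating the
    base at [0] gives a function that is continuous everywhere and agrees with
    it where the density lives, so that the density may vanish a priori. *)
Lemma continuous_powR_maxr0 (R : realType) (a : R) : 0 < a ->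
  continuous (fun y : R => Num.max y 0 `^ a).
Proof.
move=> a0 y; case: (ltgtP y 0) => [y0|y0|->].
- have le0 z : z <= 0 -> Num.max z 0 `^ a = 0.
    by move=> z0; rewrite max_r// powR0// gt_eqF.
  rewrite /continuous_at (le0 y) ?ltW//.
  apply: cvg_near_cst; near=> z; rewrite le0//.
  by apply/ltW; near: z; exact: lt_nbhsl.
- have pos z : 0 < z -> Num.max z 0 `^ a = z `^ a.
    by move=> z0; rewrite max_l// ltW.
  rewrite /continuous_at (pos y)//.
  apply: (@cvg_trans _ (z `^ a @[z --> y])).
    by apply: near_eq_cvg; near=> z; rewrite pos//; near: z; exact: lt_nbhsr.
  apply: (@differentiable_continuous _ _ _ y (@powR R ^~ a)).
  by apply/derivable1_diffP/derivable_powR; rewrite in_itv/= andbT.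
- apply/continuous_withinNx; rewrite maxxx powR0 ?gt_eqF//.
  apply: (@cvg_at_right_left_dnbhs _ R^o).
    apply: cvg_trans (powR_cvg0 a0); apply: near_eq_cvg.
    by near=> z; rewrite max_l.
  by apply: cvg_near_cst; near=> z; rewrite max_r// powR0// gt_eqF.
Unshelve. all: by end_near. Qed.

(** Reads the one-variable derivative off the relative one: near an interior
    point, the restriction to [D] in the difference quotient is vacuous. *)
Lemma derive1_interior (R : realType) (D : set R) (f : R -> R) (x l : R) :
  has_derive_within D f x l -> nbhs x D ->
  derivable f x 1 /\ f^`()%classic x = l.
Proof.
move=> fl xD.
suff fl0 : h^-1 *: (f (h *: 1 + x) - f x) @[h --> 0^'] --> l.
  split; first by apply/cvg_ex; exists l.
  by rewrite derive1E; exact: cvg_lim fl0.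
have sh : h + x @[h --> 0^'] --> within D x^'.
  move=> A xA.
  have {}xA : nbhs x (fun y => y != x -> D y -> A y) by exact: xA.
  have /nbhs_ballP[e /= e0 eA] : nbhs x (fun y => y != x -> A y).
    by near=> y => yx; apply: (near xA y) => //; apply: (near xD y).
  apply/nbhs_ballP; exists e => //= h he h0; apply: eA.
    by move: he; rewrite /ball/= sub0r normrN opprD addrCA subrr addr0 normrN.
  by rewrite -subr_eq0 addrK.
apply: cvg_trans (cvg_comp _ _ sh fl); apply: near_eq_cvg; near=> h.
by rewrite /= addrK [h *: 1]mulr1 mulrC.
Unshelve. all: by end_near. Qed.

(** * The state behind the precursor shock *)

Section PrecursorState.
Variables (R : realType) (gamma_u rho0 p0 sigma_p : R).
Hypotheses (gamma_u_gt1 : 1 < gamma_u) (rho0_gt0 : 0 < rho0) (p0_gt0 : 0 < p0).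
Hypothesis sigma_p_gt : c0 gamma_u rho0 p0 < sigma_p.

Local Notation c0 := (c0 gamma_u rho0 p0).
Local Notation M_p := (M_p gamma_u rho0 p0 sigma_p).
Local Notation rho1 := (rho1 gamma_u rho0 p0 sigma_p).
Local Notation u1 := (u1 gamma_u rho0 p0 sigma_p).
Local Notation p1 := (p1 gamma_u rho0 p0 sigma_p).
Local Notation s1 := (s1 gamma_u rho0 p0 sigma_p).
Local Notation sound_speed := (sound_speed gamma_u rho0 p0 sigma_p).
Local Notation is_solution := (is_solution gamma_u rho0 p0 sigma_p).

Let gamma_u_gt0 : 0 < gamma_u. Proof. exact: lt_trans gamma_u_gt1. Qed.

Lemma c0_gt0 : 0 < c0.
Proof. by rewrite sqrtr_gt0 divr_gt0// mulr_gt0. Qed.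

Lemma sigma_p_gt0 : 0 < sigma_p. Proof. exact: lt_trans c0_gt0 sigma_p_gt. Qed.

(** Clears [c0], and with it the square root, from the computations: both sides
    are the square of [c0]. *)
Lemma invM_p2 : M_p ^- 2 * sigma_p ^+ 2 = gamma_u * p0 / rho0.
Proof.
have s0 := lt0r_neq0 sigma_p_gt0.
rewrite expr_div_n invf_div mulfVK ?expf_neq0// sqr_sqrtr//.
by rewrite divr_ge0 ?mulr_ge0// ltW.
Qed.

Lemma invM_p2_gt0 : 0 < M_p ^- 2.
Proof. by rewrite invr_gt0 exprn_gt0// divr_gt0 ?sigma_p_gt0 ?c0_gt0. Qed.

Lemma invM_p2_lt1 : M_p ^- 2 < 1.
Proof.
have M1 : 1 < M_p by rewrite ltr_pdivlMr ?mul1r// c0_gt0.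
by rewrite invf_lt1 ?exprn_egt1// exprn_gt0// (lt_trans ltr01 M1).
Qed.

(** The density ratio across the shock is affine in [M_p ^- 2], which makes every
    inequality below linear. *)
Lemma rho0_div_rho1 :
  rho0 / rho1 = (gamma_u - 1 + 2 * M_p ^- 2) / (gamma_u + 1).
Proof.
rewrite /Defs.rho1; move: (M_p ^- 2) invM_p2_gt0 => m m0.
have g1 := gamma_u_gt1.
have gD : 0 < gamma_u + 1 by lra.
have gB : 0 < gamma_u - 1 + 2 * m by lra.
by field; rewrite !lt0r_neq0.
Qed.

Lemma rho0_div_rho1_gt0 : 0 < rho0 / rho1.
Proof.
have g1 := gamma_u_gt1; have m := invM_p2_gt0.
by rewrite rho0_div_rho1 divr_gt0//; lra.
Qed.

Lemma rho0_div_rho1_lt1 : rho0 / rho1 < 1.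
Proof.
have g1 := gamma_u_gt1; have m := invM_p2_lt1.
by rewrite rho0_div_rho1 ltr_pdivrMr ?mul1r; lra.
Qed.

Lemma rho1_gt0 : 0 < rho1.
Proof. by have := rho0_div_rho1_gt0; rewrite pmulr_rgt0// invr_gt0. Qed.

Lemma u1_gt0 : 0 < u1.
Proof. by rewrite mulr_gt0 ?sigma_p_gt0// subr_gt0 rho0_div_rho1_lt1. Qed.

Lemma p1_gt0 : 0 < p1.
Proof.
rewrite addr_gt0// mulr_gt0 ?exprn_gt0 ?sigma_p_gt0// mulr_gt0//.
by rewrite subr_gt0 rho0_div_rho1_lt1.
Qed.

Lemma s1_gt0 : 0 < s1.
Proof. by rewrite divr_gt0 ?p1_gt0 ?powR_gt0 ?rho1_gt0. Qed.

Lemma sqr_sound_speed rho x :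
  sound_speed rho x ^+ 2 = gamma_u * s1 * rho x `^ (gamma_u - 1).
Proof.
rewrite sqr_sqrtr// mulr_ge0 ?powR_ge0//.
by rewrite mulr_ge0 ?(ltW s1_gt0)// ltW// gamma_u_gt0.
Qed.

(** The Lax condition: the shock runs slower than sound relative to the gas
    behind it. With [t] the ratio [rho0 / rho1], the two sides are
    [t ^+ 2 * sigma_p ^+ 2] and
    [t * sigma_p ^+ 2 * (M_p ^- 2 + gamma_u * (1 - t))]; as
    [(gamma_u + 1) * t = gamma_u - 1 + 2 * M_p ^- 2], their comparison is
    exactly [M_p ^- 2 < 1]. *)
Lemma subsonic_behind_shock rho : rho sigma_p = rho1 ->
  (u1 - sigma_p) ^+ 2 < sound_speed rho sigma_p ^+ 2.
Proof.
move=> rhoE; rewrite sqr_sound_speed rhoE.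
have r1 := lt0r_neq0 rho1_gt0; have r0 := lt0r_neq0 rho0_gt0.
have -> : gamma_u * s1 * rho1 `^ (gamma_u - 1) =
    rho0 / rho1 * sigma_p ^+ 2 *
    (M_p ^- 2 + gamma_u * (1 - rho0 / rho1)).
  have -> : rho1 `^ (gamma_u - 1) = rho1 `^ gamma_u / rho1.
    by rewrite powRB ?r1 ?implybT// powRr1// ltW// rho1_gt0.
  have -> : rho0 / rho1 * sigma_p ^+ 2 *
      (M_p ^- 2 + gamma_u * (1 - rho0 / rho1)) =
      rho0 / rho1 * (M_p ^- 2 * sigma_p ^+ 2 +
        gamma_u * (1 - rho0 / rho1) * sigma_p ^+ 2) by ring.
  rewrite invM_p2 /Defs.s1 /Defs.p1.
  have P := lt0r_neq0 (powR_gt0 gamma_u rho1_gt0).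
  by field; rewrite r0 r1 P.
have -> : (u1 - sigma_p) ^+ 2 = rho0 / rho1 * sigma_p ^+ 2 * (rho0 / rho1).
  by rewrite /Defs.u1; ring.
rewrite ltr_pM2l; last first.
  by rewrite mulr_gt0 ?rho0_div_rho1_gt0// exprn_gt0 ?sigma_p_gt0.
have : rho0 / rho1 * (gamma_u + 1) = gamma_u - 1 + 2 * M_p ^- 2.
  by rewrite rho0_div_rho1 divfK// lt0r_neq0// addr_gt0.
have := invM_p2_lt1; lra.
Qed.

(** * Monotonicity of a solution *)

Section Solution.
Variables (sigma : R) (rho u : R -> R).
Hypothesis sigma_itv : 0 <= sigma < sigma_p.
Hypothesis rho_u_sol : is_solution sigma rho u.
Hypothesis rho_u_adm : admissible sigma_p sigma rho u.

(** A sonic point between [x] and [sigma_p] would contradict the nonvanishing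
    condition in the definition of a solution. The left end-point is excluded:
    it may be [0], where that condition is not imposed. *)
Lemma subsonic x : sigma < x <= sigma_p ->
  (u x - x) ^+ 2 < sound_speed rho x ^+ 2.
Proof.
move=> /andP[sx xs]; have [[crho cu] rho_ge0 nonsonic _ [rhoE uE]] := rho_u_sol.
have /andP[sg0 _] := sigma_itv.
have sub : `[x, sigma_p] `<=` `[sigma, sigma_p].
  by apply: subset_itvr; rewrite bnd_simp ltW.
have D y : y \in `[x, sigma_p] -> y \in `[sigma, sigma_p] /\ 0 < y.
  move=> xy; split; first exact: sub.
  by rewrite (le_lt_trans sg0)// (lt_le_trans sx)// (itvP xy).
(* [F] is the difference of the two sides, with the density truncated at [0]
   so that it is continuous; see [continuous_powR_maxr0]. *)
pose F y := (u y - y) ^+ 2 -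
  gamma_u * s1 * Num.max (rho y) 0 `^ (gamma_u - 1).
have FE y : y \in `[x, sigma_p] -> F y = (u y - y) ^+ 2 - sound_speed rho y ^+ 2.
  move=> /D[Iy _]; rewrite /F sqr_sound_speed max_l//; exact: rho_ge0.
have cF : {within `[x, sigma_p], continuous F}.
  have {}crho := continuous_subspaceW sub crho.
  have {}cu := continuous_subspaceW sub cu.
  have cid : {within `[x, sigma_p], continuous (@id R)}.
    by apply: continuous_subspaceT => z; exact: cvg_id.
  have cw : {within `[x, sigma_p], continuous (fun y => u y - y)}.
    by move=> z; apply: cvgB; [exact: cu|exact: cid].
  have cw2 := @within_continuous_comp _ _ _ _ _ (fun t : R => t ^+ 2)
    (in1W (@exprn_continuous R 2)) cw.
  have gamma_u1 : 0 < gamma_u - 1 by rewrite subr_gt0.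
  have cp := @within_continuous_comp _ _ _ _ _ _
    (in1W (continuous_powR_maxr0 gamma_u1)) crho.
  move=> z; apply: cvgB; first exact: cw2.
  by apply: cvgM; [exact: cvg_cst|exact: cp].
have xI : x \in `[x, sigma_p] by rewrite in_itv/= lexx.
have sI : sigma_p \in `[x, sigma_p] by rewrite in_itv/= lexx andbT.
have Fs : F sigma_p < 0.
  by rewrite FE// subr_lt0 uE subsonic_behind_shock.
rewrite -subr_lt0 -FE// ltNge; apply/negP => Fx.
have [|y yI Fy0] := @IVT _ F x sigma_p 0 xs cF.
  by rewrite ge_min le_max Fx (ltW Fs) orbT.
by have := nonsonic y (D y yI); rewrite -FE// Fy0 eqxx.
Qed.

(** The system with signs made explicit. In the subsonic regime
    [q = - 2 / (x * ((u x - x) ^+ 2 - c x ^+ 2))] is positive. *)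
Lemma solution_derive1 x : x \in `]sigma, sigma_p[ ->
  [/\ derivable rho x 1, derivable u x 1 &
    exists2 q, 0 < q &
      rho^`()%classic x = - (q * (u x * (x - u x) * rho x)) /\
      u^`()%classic x = - (q * (sound_speed rho x ^+ 2 * u x))].
Proof.
move=> xI; have /andP[sx xs] : sigma < x < sigma_p by move: xI; rewrite in_itv.
have [_ _ _ [rho' [u' [[drho _] [du _] rho'E u'E]]] _] := rho_u_sol.
have /andP[sg0 _] := sigma_itv.
have x0 : 0 < x by exact: le_lt_trans sx.
have nD : nbhs x ([set` `[sigma, sigma_p]] `&` [set y | 0 < y]).
  near=> y; split=> /=.
    apply: subset_itv_oo_cc; near: y; exact: near_in_itvoo.
  near: y; exact: lt_nbhsr.
have Dx := nbhs_singleton nD.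
have F0 : (u x - x) ^+ 2 - sound_speed rho x ^+ 2 < 0.
  by rewrite subr_lt0 subsonic// sx ltW.
have [drhox rho'x] := derive1_interior (drho x Dx) nD.
have [dux u'x] := derive1_interior (du x Dx) nD.
split=> //; rewrite rho'x u'x rho'E// u'E//.
exists (- (2 / (x * ((u x - x) ^+ 2 - sound_speed rho x ^+ 2)))).
  by rewrite oppr_gt0 pmulr_rlt0// invr_lt0 pmulr_rlt0.
by split; ring.
Unshelve. all: by end_near. Qed.

Lemma solution_nonincreasing :
  {in `[sigma, sigma_p] &, {homo rho : x y /~ x <= y}} /\
  {in `[sigma, sigma_p] &, {homo u : x y /~ x <= y}}.
Proof.
have [[crho cu] _ _ _ _] := rho_u_sol.
have adm x : x \in `]sigma, sigma_p[ -> [/\ 0 <= u x, 0 <= x - u x & 0 <= rho x].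
  move=> /(@subset_itv_oo_cc _ _ _ _ x)/rho_u_adm[/andP[ux0 uxx] rhox0].
  by rewrite subr_ge0.
split; apply: ler0_derive1_le_cc => // x xI;
  have [drho du [q q0 [rho'x u'x]]] := solution_derive1 xI => //;
  have [ux0 xux rhox0] := adm x xI.
- by rewrite rho'x oppr_le0 (mulr_ge0 (ltW q0))// !mulr_ge0.
- by rewrite u'x oppr_le0 (mulr_ge0 (ltW q0))// mulr_ge0// sqr_ge0.
Qed.

Lemma solution_lower_bound x : x \in `[sigma, sigma_p] ->
  rho1 <= rho x /\ u1 <= u x.
Proof.
move=> xI; have [_ _ _ _ [<- <-]] := rho_u_sol.
have [rho_ninc u_ninc] := solution_nonincreasing.
have sI : sigma_p \in `[sigma, sigma_p].
  by rewrite in_itv/= lexx andbT ltW//; case/andP: sigma_itv.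
have xs : x <= sigma_p by rewrite (itvP xI).
by split; [exact: rho_ninc|exact: u_ninc].
Qed.

(** The factors that [solution_nonincreasing] only knows to be nonnegative are
    positive, by the lower bounds [rho1] and [u1] that it yields. *)
Lemma solution_decreasing :
  {in `[sigma, sigma_p] &, {homo rho : x y /~ x < y}} /\
  {in `[sigma, sigma_p] &, {homo u : x y /~ x < y}}.
Proof.
have [[crho cu] _ _ _ _] := rho_u_sol.
have pos x : x \in `]sigma, sigma_p[ -> [/\ 0 < u x, 0 < x - u x & 0 < rho x].
  move=> xI; have xI' := @subset_itv_oo_cc _ _ _ _ x xI.
  have [rhox ux] := solution_lower_bound xI'.
  split; [exact: lt_le_trans u1_gt0 ux| |exact: lt_le_trans rho1_gt0 rhox].
  (* [u x < x] follows from [u x <= u sigma <= sigma < x]. *)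
  have sx : sigma < x by rewrite (itvP xI).
  have sI : sigma \in `[sigma, sigma_p].
    by rewrite in_itv/= lexx ltW//; case/andP: sigma_itv.
  have [/andP[_ us] _] := rho_u_adm sI.
  rewrite subr_gt0 (le_lt_trans _ sx)// (le_trans _ us)//.
  by have [_ u_ninc] := solution_nonincreasing; apply: u_ninc => //; exact: ltW.
split; apply: ltr0_derive1_lt_cc => // x xI;
  have [drho du [q q0 [rho'x u'x]]] := solution_derive1 xI => //;
  have [ux0 xux rhox0] := pos x xI.
- by rewrite rho'x oppr_lt0 (mulr_gt0 q0)// !mulr_gt0.
- rewrite u'x oppr_lt0 (mulr_gt0 q0)// mulr_gt0// sqr_sound_speed.
  by rewrite mulr_gt0 ?powR_gt0// mulr_gt0 ?gamma_u_gt0 ?s1_gt0.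
Qed.

End Solution.

(** * The end-point [sigma_l] *)

(** If no [sigma] carries an admissible solution, the infimum takes its default
    value [0], which lies in the interval as well. *)
Lemma sigma_l_itv : 0 <= sigma_l gamma_u rho0 p0 sigma_p < sigma_p.
Proof.
rewrite /sigma_l; set S := [set sigma | _].
have [->|S0] := eqVneq S set0; first by rewrite inf0 lexx sigma_p_gt0.
move/set0P : S0 => S0; apply/andP; split.
  by apply: lb_le_inf => // s [/andP[]].
have [s Ss] := S0; have [/andP[_ ss] _] := Ss.
apply: le_lt_trans ss; apply: ge_inf Ss.
by exists 0 => t [/andP[]].
Qed.

End PrecursorState.

Theorem lemma2p2 (R : realType) (gamma_u rho0 p0 sigma_p : R)
    (gamma_u_gt1 : 1 < gamma_u) (rho0_gt0 : 0 < rho0) (p0_gt0 : 0 < p0)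
    (sigma_p_gt : c0 gamma_u rho0 p0 < sigma_p)
    (rho u : R -> R)
    (rho_u_sol : is_solution gamma_u rho0 p0 sigma_p
                   (sigma_l gamma_u rho0 p0 sigma_p) rho u)
    (rho_u_adm : admissible sigma_p (sigma_l gamma_u rho0 p0 sigma_p) rho u) :
  [/\ {in `[sigma_l gamma_u rho0 p0 sigma_p, sigma_p] &,
        {homo rho : x y /~ x < y}},
      {in `[sigma_l gamma_u rho0 p0 sigma_p, sigma_p] &,
        {homo u : x y /~ x < y}},
      0 < rho1 gamma_u rho0 p0 sigma_p,
      0 < u1 gamma_u rho0 p0 sigma_p
    & forall x, x \in `[sigma_l gamma_u rho0 p0 sigma_p, sigma_p] ->
        rho1 gamma_u rho0 p0 sigma_p <= rho x /\
        u1 gamma_u rho0 p0 sigma_p <= u x].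
Proof.
have sigma_itv := sigma_l_itv gamma_u_gt1 rho0_gt0 p0_gt0 sigma_p_gt.
have [rho_decr u_decr] := solution_decreasing gamma_u_gt1 rho0_gt0 p0_gt0
  sigma_p_gt sigma_itv rho_u_sol rho_u_adm.
split=> //; [exact: rho1_gt0|exact: u1_gt0|].
exact: (solution_lower_bound gamma_u_gt1 rho0_gt0 p0_gt0 sigma_p_gt
  sigma_itv rho_u_sol rho_u_adm).
Qed.
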